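(* Let $N\geq 1$, $m\geq 1$ and $r$ be integers with $r\geq m^N$. Let $Z\subset\mathbb{P}^N$ be a set of $r$ very general points and let $I\subset\mathbb{C}[x_0,\ldots,x_N]$ be the homogeneous saturated ideal defining $Z$. Then Demailly's inequality $$\widehat{\alpha}(\mathbb{P}^N;I)\geq\frac{\alpha(\mathbb{P}^N;I^{(m)})+N-1}{m+N-1}$$ holds.
   Context: The base field is $\mathbb{C}$. For the saturated ideal $I$ of a non-empty finite set of points $Z\subset\mathbb{P}^N$, $I^{(m)}=\bigcap_{P\in Z}I(P)^m$ denotes the $m$-th symbolic power (generated by forms vanishing to order at least $m$ at every point of $Z$). For a non-zero proper homogeneous ideal $J\subset\mathbb{C}[x_0,\ldots,x_N]$, $\alpha(\mathbb{P}^N;J)=\min\{d:J_d\neq 0\}$ is its initial degree, where $J_d$ is the degree $d$ part of $J$. The Waldschmidt constant of $I$ is $\widehat{\alpha}(\mathbb{P}^N;I)=\inf_{m\geq 1}\alpha(\mathbb{P}^N;I^{(m)})/m$. ''Very general'' means that the $r$-tuple of points lies outside a suitable countable union of proper closed subvarieties of $(\mathbb{P}^N)^r$. *)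

(* Defs.v *)
From HB Require Import structures.
From mathcomp Require Import all_boot all_order all_algebra.
From mathcomp Require Import boolp classical_sets reals.
From mathcomp Require Import complex mpoly.

Set Implicit Arguments.
Unset Strict Implicit.
Unset Printing Implicit Defensive.

Import Order.TTheory GRing.Theory Num.Theory.

Local Open Scope classical_set_scope.
Local Open Scope ring_scope.

Section ProjectiveSpace.
Variable K : fieldType.

(* The points of P^N are the lines through the origin of K^(N+1). *)
Definition proj_space (N : nat) : Type :=
  {U : {vspace 'rV[K]_N.+1} | \dim U == 1%N}.

Definition represents (N : nat) (v : 'rV[K]_N.+1) (P : proj_space N) : Prop :=
  v != 0 /\ v \in sval P.

Definition vanishes_at (N : nat) (f : {mpoly K[N.+1]}) (P : proj_space N) :
  Prop := forall v, represents v P -> f.@[v ord0] = 0.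

(* (P^N)^r has multihomogeneous coordinates the entries of an r x (N+1)
   matrix, whose i-th row represents the i-th point; the corresponding
   r * (N+1) polynomial variables are indexed through mxvec_index. *)
Definition is_multihomog (N r : nat) (d : 'I_r -> nat)
    (f : {mpoly K[r * N.+1]}) : Prop :=
  forall mon, mon \in msupp f ->
  forall i : 'I_r, (\sum_(j < N.+1) mon (mxvec_index i j))%N = d i.

Definition vanishes_at_tuple (N r : nat) (f : {mpoly K[r * N.+1]})
    (p : 'I_r -> proj_space N) : Prop :=
  forall A : 'M[K]_(r, N.+1),
    (forall i, represents (row i A) (p i)) -> f.@[mxvec A ord0] = 0.

Definition is_closed (N r : nat) (V : set ('I_r -> proj_space N)) : Prop :=
  exists S : set {mpoly K[r * N.+1]},
    (forall f, S f -> exists d, is_multihomog d f) /\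
    V = [set p | forall f, S f -> vanishes_at_tuple f p].

(* Closed subsets need not be irreducible here: each one is a finite union of
   irreducible ones, so countable unions of either kind are the same. *)
Definition for_very_general (N r : nat) (Q : ('I_r -> proj_space N) -> Prop) :
    Prop :=
  exists W : nat -> set ('I_r -> proj_space N),
    (forall k, is_closed (W k) /\ W k <> setT) /\
    (forall p, ~ (\bigcup_k W k) p -> Q p).

End ProjectiveSpace.

Section Ideals.
Variables (K : fieldType) (n : nat).
Implicit Types (S J : set {mpoly K[n]}).

Definition ideal_gen S : set {mpoly K[n]} :=
  [set f | exists (k : nat) (a s : 'I_k -> {mpoly K[n]}),
     (forall i, S (s i)) /\ f = \sum_(i < k) a i * s i].

Definition ideal_pow J (m : nat) : set {mpoly K[n]} :=
  ideal_gen [set f | exists g : 'I_m -> {mpoly K[n]},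
    (forall i, J (g i)) /\ f = \prod_(i < m) g i].

Definition has_form J (d : nat) : Prop :=
  exists f : {mpoly K[n]}, [/\ J f, f != 0 & f \is d.-homog].

(* The junk value 0 is only used when J contains no nonzero form. *)
Definition initial_degree J : nat :=
  if pselect (exists d, `[< has_form J d >]) is left h then ex_minn h else 0%N.

End Ideals.

Section SymbolicPowers.
Variables (K : fieldType) (N : nat).
Implicit Types (P : proj_space K N) (Z : set (proj_space K N)).

Definition point_ideal P : set {mpoly K[N.+1]} :=
  ideal_gen [set f | (exists d, f \is d.-homog) /\ vanishes_at f P].

(* With I the saturated ideal of Z, this is I^(m); I itself is I^(1). *)
Definition symbolic_power Z (m : nat) : set {mpoly K[N.+1]} :=
  \bigcap_(P in Z) ideal_pow (point_ideal P) m.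

Definition waldschmidt (R : realType) Z : R :=
  inf [set (initial_degree (symbolic_power Z m))%:R / m%:R
      | m in [set m : nat | (1 <= m)%N]].

End SymbolicPowers.

(* Main.v *)
Require Import Defs.
From HB Require Import structures.
From mathcomp Require Import all_boot all_order all_algebra.
From mathcomp Require Import boolp classical_sets reals.
From mathcomp Require Import complex mpoly.
From mathcomp Require Import zify.

(** Why the inequality holds.  Write D = alpha(I^(m)) + N - 1 and M = m + N - 1,
    so that the claim is that every form of degree d vanishing to order m' at the
    very general points satisfies D m' <= M d.

    Having a nonzero form of degree d through the points with multiplicity m' is
    a closed condition on the points, so for each pair (d, m') it is enough to
    find one r-tuple of points without such a form: some maximal minor of the
    matrix of vanishing conditions is then nonzero at this tuple, and the tuples
    where that minor vanishes form a proper closed subset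
    ([isolating_very_general]).  Countably many pairs give a very general tuple.

    Two families of special tuples, both made of lattice points, are used.
    - r points of the grid {0, .., c-1}^N with r <= c^N:  the Schwartz-Zippel
      inequality with multiplicities gives r m' <= c^(N-1) d
      ([multiplicity_schwartz_zippel]).
    - The 'C(N + s, N) points of N^N of coordinate sum at most s, for which
      (N + s) m' <= N d ([simplex_bound]).
    Both are proved by induction on N: the equations of the hyperplanes x_0 = const
    that carry the points (all of them for the grid, only the first one for the
    simplex) are divided out, and the quotient is restricted to them.

    On the other side, counting conditions bounds the initial degree: if
    r 'C(m + N - 1, N) < 'C(d + N, N), then I^(m) contains a form of degree d,
    whatever the points ([symbolic_power_has_form]).  Applied to
    d = alpha(I^(m)) - 1, which is too small, it yields
    'C(D, N) <= r 'C(M, N).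

    It remains to compare.  If D / M <= m, the grid with c = m suffices since
    r >= m^N.  If m = 1, the simplex with s = alpha(I) - 1 gives exactly D / N.
    Otherwise let c be the ceiling of D / M; the grid gives
    min(c, r / c^(N-1)) >= D / M as soon as D c^(N-1) <= r M, and this follows
    from the binomial inequality by comparing the factors of the two falling
    factorials in pairs ([paired_factors_leq], [ratio_bound_of_bin]). *)

Set Implicit Arguments.
Unset Strict Implicit.
Unset Printing Implicit Defensive.

Import Order.TTheory GRing.Theory Num.Theory.
Local Open Scope classical_set_scope.
Local Open Scope ring_scope.

(** * Vanishing orders, read along a generic line *)

Lemma eq_mpoly_rmorphism (R : nzRingType) (S : nzRingType) n
    (phi psi : {rmorphism {mpoly R[n]} -> S}) :
  (forall c, phi c%:MP = psi c%:MP) -> (forall i, phi 'X_i = psi 'X_i) ->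
  phi =1 psi.
Proof.
move=> hC hX f; rewrite [f]mpolyE !rmorph_sum; apply: eq_bigr => a _.
rewrite -mul_mpolyC !rmorphM hC mpolyXE_id !rmorph_prod; congr (_ * _).
by apply: eq_bigr => i _; rewrite !rmorphXn hX.
Qed.

Section TruncationOrder.
Variable A : idomainType.
Implicit Types (F G : {poly A}).

Definition order_ge m F := forall j, (j < m)%N -> F`_j = 0.

Lemma order_ge_mul m k F G :
  order_ge m F -> order_ge k G -> order_ge (m + k) (F * G).
Proof.
move=> hF hG j hj; rewrite coefM big1 // => i _.
case: (ltnP i m) => hi; first by rewrite hF // mul0r.
by rewrite hG ?mulr0 //; have := ltn_ord i; lia.
Qed.

Lemma order_ge_cancel_unit m F G :
  F`_0 != 0 -> order_ge m (F * G) -> order_ge m G.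
Proof.
move=> hF hFG j; have [k] := ubnP j; elim: k j => // k IH j hjk hj.
have := hFG j hj; rewrite coefM big_ord_recl /= subn0 big1 => [|i _]; last first.
  by rewrite (IH (j - bump 0 i)%N) ?mulr0 //; rewrite /bump /=; have := ltn_ord i; lia.
by move/eqP; rewrite addr0 mulf_eq0 (negbTE hF) => /eqP.
Qed.

Lemma order_ge_cancel_X m a G :
  a != 0 -> order_ge m (a%:P * 'X * G) -> order_ge m.-1 G.
Proof.
move=> ha h j hj; have hj' : (j.+1 < m)%N by lia.
have := h _ hj'; rewrite -mulrA coefCM coefXM /= => /eqP.
by rewrite mulf_eq0 (negbTE ha) => /eqP.
Qed.

End TruncationOrder.

Lemma order_ge_map (A B : idomainType) (phi : {rmorphism A -> B}) m
    (F : {poly A}) :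
  order_ge m F -> order_ge m (map_poly phi F).
Proof. by move=> h j hj; rewrite coef_map (h _ hj) raddf0. Qed.

Section Lines.
Variables (K : numFieldType).

(** f(v + T h), as a polynomial in T whose coefficients are polynomials in the
    direction h.  The coefficient of T^j collects the terms of order j of the
    Taylor expansion of f at v, so that vanishing to order m at v becomes
    divisibility by T^m, in a univariate polynomial ring over a domain. *)
Definition line_expansion n (v : 'I_n -> K) : {mpoly K[n]} -> {poly {mpoly K[n]}} :=
  mmap (polyC \o @mpolyC n K) (fun i => (v i)%:MP%:P + ('X_i)%:P * 'X).
HB.instance Definition _ n v := GRing.RMorphism.on (@line_expansion n v).

Definition vanishes_to n (v : 'I_n -> K) m f := order_ge m (line_expansion v f).

Lemma line_expansionC n (v : 'I_n -> K) c : line_expansion v c%:MP = c%:MP%:P.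
Proof. by rewrite /line_expansion mmapC. Qed.
Lemma line_expansionX n (v : 'I_n -> K) i :
  line_expansion v 'X_i = (v i)%:MP%:P + ('X_i)%:P * 'X.
Proof. by rewrite /line_expansion mmapX mmap1U. Qed.

(** Substitution of the constant c for the first variable.  For c = 1 this is also
    the dehomogenization of forms. *)
Definition slice n (c : K) : {mpoly K[n.+1]} -> {mpoly K[n]} :=
  mmap (@mpolyC n K) (fun i => if unlift ord0 i is Some j then 'X_j else c%:MP).
HB.instance Definition _ n c := GRing.RMorphism.on (@slice n c).

Lemma sliceC n c a : @slice n c a%:MP = a%:MP.
Proof. by rewrite /slice mmapC. Qed.
Lemma sliceX0 n c : @slice n c 'X_ord0 = c%:MP.
Proof. by rewrite /slice mmapX mmap1U unlift_none. Qed.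
Lemma sliceXS n c i : @slice n c 'X_(lift ord0 i) = 'X_i.
Proof. by rewrite /slice mmapX mmap1U liftK. Qed.

(** Restricting a line to a hyperplane that contains its base point amounts to
    killing the first coordinate of its direction. *)
Lemma line_expansion_slice n (v : 'I_n.+1 -> K) f :
  line_expansion (v \o lift ord0) (slice (v ord0) f)
  = map_poly (slice 0) (line_expansion v f).
Proof.
apply: (@eq_mpoly_rmorphism K {poly {mpoly K[n]}} n.+1
  (line_expansion (v \o lift ord0) \o @slice n (v ord0))
  (map_poly (@slice n 0) \o @line_expansion _ v)) => [c|i] /=.
  by rewrite sliceC !line_expansionC map_polyC /= sliceC.
rewrite line_expansionX rmorphD rmorphM /= !map_polyC map_polyX /= sliceC.
case: (unliftP ord0 i) => [j|] ->.
  by rewrite !sliceXS line_expansionX.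
by rewrite !sliceX0 line_expansionC mpolyC0 polyC0 mul0r addr0.
Qed.

Lemma vanishes_to_slice n (v : 'I_n.+1 -> K) m f :
  vanishes_to v m f -> vanishes_to (v \o lift ord0) m (slice (v ord0) f).
Proof. by move=> h; rewrite /vanishes_to line_expansion_slice; apply: order_ge_map. Qed.

Definition extend n : {mpoly K[n]} -> {mpoly K[n.+1]} :=
  mmap (@mpolyC n.+1 K) (fun j => 'X_(lift ord0 j)).
HB.instance Definition _ n := GRing.RMorphism.on (@extend n).

(** Modulo x_0 - c every polynomial agrees with its slice; this congruence is stable
    under sums and products and clear on the variables. *)
Lemma hyperplane_division n c (f : {mpoly K[n.+1]}) :
  exists g : {mpoly K[n.+1]}, f = extend (slice c f) + ('X_ord0 - c%:MP) * g.
Proof.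
have eC a : extend (a%:MP : {mpoly K[n]}) = a%:MP by rewrite /extend mmapC.
pose P (f : {mpoly K[n.+1]}) :=
  exists g : {mpoly K[n.+1]}, f = extend (slice c f) + ('X_ord0 - c%:MP) * g.
have PC a : P a%:MP by exists 0; rewrite sliceC eC mulr0 addr0.
have PD f1 f2 : P f1 -> P f2 -> P (f1 + f2).
  move=> [g1 h1] [g2 h2]; exists (g1 + g2).
  by rewrite {1}h1 {1}h2 !rmorphD /= mulrDr addrACA.
have PM f1 f2 : P f1 -> P f2 -> P (f1 * f2).
  move=> [g1 h1] [g2 h2].
  exists (extend (slice c f1) * g2 + g1 * f2); rewrite !rmorphM /= mulrDr.
  by rewrite [X in _ + (X + _)]mulrCA addrA -mulrDr -h2 mulrA -mulrDl -h1.
have P1 : P 1 by rewrite -mpolyC1; apply: PC.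
have PX i : P 'X_i.
  case: (unliftP ord0 i) => [j|] ->.
    by exists 0; rewrite sliceXS /extend mmapX mmap1U mulr0 addr0.
  by exists 1; rewrite sliceX0 eC mulr1 addrC subrK.
suff : P f by [].
rewrite [f]mpolyE.
apply: big_ind => [||a _]; [by rewrite -mpolyC0; apply: PC|exact: PD|].
rewrite -mul_mpolyC mpolyXE_id; apply: (PM _ _); first exact: PC.
apply: (big_ind P P1 PM) => i _; elim: (a i) => [|k IH]; first by rewrite expr0.
by rewrite exprS; apply: PM.
Qed.

Lemma msize_hyperplane n c : msize ('X_ord0 - c%:MP : {mpoly K[n.+1]}) = 2%N.
Proof.
apply/eqP; rewrite eqn_leq; apply/andP; split.
  rewrite (leq_trans (msizeD_le _ _)) // msizeN msizeX mdeg1 msizeC.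
  by case: (c != 0).
have := @msize_mdeg_lt _ _ ('X_ord0 - c%:MP : {mpoly K[n.+1]}) U_(ord0).
rewrite mdeg1; apply; rewrite mcoeff_msupp mcoeffB mcoeffX mcoeffC eqxx.
by rewrite mnm1_eq0 mulr0 subr0 oner_eq0.
Qed.

Lemma hyperplane_neq0 n c : ('X_ord0 - c%:MP : {mpoly K[n.+1]}) != 0.
Proof. by rewrite -msize_poly_eq0 msize_hyperplane. Qed.

Lemma slice_neq0 n c (f : {mpoly K[n.+1]}) : slice c f != 0 -> f != 0.
Proof. by apply: contraNneq => ->; rewrite rmorph0. Qed.

(** * Two lattice configurations imposing a high degree *)

Lemma strip_hyperplane n c (f : {mpoly K[n.+1]}) : f != 0 ->
  exists e (g : {mpoly K[n.+1]}), f = ('X_ord0 - c%:MP) ^+ e * g /\ slice c g != 0.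
Proof.
have [k] := ubnP (msize f); elim: k f => // k IH f hk f0.
have [r0|r0] := eqVneq (slice c f) 0; last first.
  by exists 0%N, f; rewrite expr0 mul1r.
have [g hg] := hyperplane_division c f.
rewrite r0 rmorph0 add0r in hg.
have g0 : g != 0 by apply: contraNneq f0 => g0; rewrite hg g0 mulr0.
have [||e [h [gE h0]]] := IH g => //.
  by move: hk; rewrite hg msizeM ?hyperplane_neq0 // msize_hyperplane add2n ltnS.
by exists e.+1, h; rewrite exprS -mulrA -gE.
Qed.

Lemma msize_strip n c e (g : {mpoly K[n.+1]}) : g != 0 ->
  msize (('X_ord0 - c%:MP) ^+ e * g) = (e + msize g)%N.
Proof.
move=> g0; elim: e => [|e IH]; first by rewrite expr0 mul1r.
rewrite exprS -mulrA msizeM ?hyperplane_neq0 //.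
  by rewrite IH msize_hyperplane; lia.
by rewrite mulf_neq0 // expf_neq0 // hyperplane_neq0.
Qed.

Lemma line_expansion_hyperplane n (v : 'I_n.+1 -> K) c :
  line_expansion v ('X_ord0 - c%:MP) = (v ord0 - c)%:MP%:P + ('X_ord0)%:P * 'X.
Proof.
by rewrite rmorphB /= line_expansionC line_expansionX addrAC mpolyCB polyCB.
Qed.

Lemma mpolyX_neq0 n (i : 'I_n) : 'X_i != 0 :> {mpoly K[n]}.
Proof. by rewrite -msize_poly_eq0 msizeX. Qed.

(** Along a line through a point of the hyperplane its equation is a multiple of T,
    so each factor costs one order of vanishing; off the hyperplane it has a
    nonzero constant term and costs nothing. *)
Lemma vanishes_to_strip_on n (v : 'I_n.+1 -> K) e m g :
  vanishes_to v m (('X_ord0 - (v ord0)%:MP) ^+ e * g) -> vanishes_to v (m - e) g.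
Proof.
elim: e g => [|e IH] g; first by rewrite subn0 expr0 mul1r.
rewrite exprSr -mulrA => /IH; rewrite /vanishes_to rmorphM /=.
rewrite line_expansion_hyperplane subrr mpolyC0 polyC0 add0r.
by move/order_ge_cancel_X => /(_ (mpolyX_neq0 _)); rewrite subnS.
Qed.

Lemma vanishes_to_strip_off n (v : 'I_n.+1 -> K) c e m g :
  v ord0 != c ->
  vanishes_to v m (('X_ord0 - c%:MP) ^+ e * g) -> vanishes_to v m g.
Proof.
move=> hc; elim: e g => [|e IH] g; first by rewrite expr0 mul1r.
rewrite exprSr -mulrA => /IH; rewrite /vanishes_to rmorphM /=.
apply: order_ge_cancel_unit; rewrite line_expansion_hyperplane.
by rewrite coefD coefC coefMX /= addr0 mpolyC_eq0 subr_eq0.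
Qed.

Lemma msizeM_leq n (p q : {mpoly K[n]}) a b :
  (msize p <= a.+1 -> msize q <= b.+1 -> msize (p * q) <= (a + b).+1)%N.
Proof.
move=> hp hq; have [->|p0] := eqVneq p 0; first by rewrite mul0r msize0.
have [->|q0] := eqVneq q 0; first by rewrite mulr0 msize0.
rewrite msizeM // -subn1 leq_subLR (leq_trans (leq_add hp hq)) //; lia.
Qed.

Lemma msize_mmap n k (h : 'I_n -> {mpoly K[k]}) (f : {mpoly K[n]}) :
  (forall i, msize (h i) <= 2)%N -> (msize (mmap (@mpolyC k K) h f) <= msize f)%N.
Proof.
move=> hh; rewrite /mmap (leq_trans (msize_sum _ _ _)) //.
apply/bigmax_leqP_seq => a ha _.
apply: leq_trans (msize_mdeg_lt ha); rewrite -[(mdeg a).+1]/((0 + mdeg a).+1).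
apply: msizeM_leq; first by rewrite msizeC; case: (_ != 0).
rewrite /mmap1 mdegE.
elim/big_ind2 : _ => [|p a1 q a2|i _]; first by rewrite msize1.
  exact: msizeM_leq.
elim: (a i) => [|e IH]; first by rewrite expr0 msize1.
by rewrite exprS; apply: (@msizeM_leq _ _ _ 1 e).
Qed.

Lemma msize_slice n c (f : {mpoly K[n.+1]}) : (msize (slice c f) <= msize f)%N.
Proof.
apply: msize_mmap => i; case: (unlift ord0 i) => [j|]; first by rewrite msizeX mdeg1.
by rewrite msizeC; case: (c != 0).
Qed.

Definition lattice_point n (z : seq nat) (i : 'I_n) : K := (nth 0%N z i)%:R.

Lemma lattice_point_behead n (z : seq nat) :
  @lattice_point n.+1 z \o lift ord0 = @lattice_point n (behead z).
Proof. by apply/funext => i /=; rewrite /lattice_point nth_behead. Qed.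

(** Divides f by the equations of all hyperplanes x_0 = c, for c in cs, as often as
    possible; e c is the multiplicity of the hyperplane x_0 = c in f.  It drops
    to 0 outside cs, so that the last clause covers every lattice point. *)
Lemma strip_hyperplanes n (cs : seq nat) (f : {mpoly K[n.+1]}) : uniq cs -> f != 0 ->
  exists (e : nat -> nat) (g : {mpoly K[n.+1]}),
    [/\ forall c, c \in cs -> slice c%:R g != 0,
        (\sum_(c <- cs) e c + msize g = msize f)%N, g != 0 &
        forall v m c, v ord0 = c%:R -> vanishes_to v m f -> vanishes_to v (m - e c) g].
Proof.
move=> ucs f0.
suff [e [g [gr gs g0 _ gv]]] : exists (e : nat -> nat) (g : {mpoly K[n.+1]}),
    [/\ forall c, c \in cs -> slice c%:R g != 0,
        (\sum_(c <- cs) e c + msize g = msize f)%N, g != 0,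
        forall c, c \notin cs -> e c = 0%N &
        forall v m c, v ord0 = c%:R -> vanishes_to v m f -> vanishes_to v (m - e c) g].
  by exists e, g.
elim: cs ucs => [|c cs IH] /=.
  move=> _; exists (fun=> 0%N), f; rewrite big_nil; split => // v m c _.
  by rewrite subn0.
move=> /andP[hc hcs]; have [e [g [gr gs g0 e0 gv]]] := IH hcs.
have [k [h [gE hr]]] := strip_hyperplane c%:R g0.
have h0 := slice_neq0 hr.
exists (fun x => if x == c then k else e x), h; split => //.
- move=> x; rewrite inE => /orP[/eqP ->//|/gr].
  by rewrite gE rmorphM mulf_eq0 negb_or => /andP[].
- rewrite -gs gE msize_strip // big_cons eqxx -addnA addnCA; congr (_ + _)%N.
  rewrite !big_seq; apply: eq_bigr => x hx; case: eqP => // xc.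
  by rewrite xc (negbTE hc) in hx.
- by move=> x; rewrite inE negb_or => /andP[/negbTE -> /e0].
move=> v m x vx /(gv _ _ _ vx); rewrite gE; case: eqP => [xc|/eqP xc].
  by rewrite xc e0 // subn0 -xc -vx => /vanishes_to_strip_on.
by apply: vanishes_to_strip_off; rewrite vx eqr_nat.
Qed.

(** The points of Z on the hyperplane x_0 = j, in the coordinates of this
    hyperplane. *)
Definition layer (Z : seq (seq nat)) j :=
  [seq behead z | z <- Z & head 0%N z == j].

Lemma layer_uniq n Z j : (forall z, z \in Z -> size z = n.+1) -> uniq Z ->
  uniq (layer Z j).
Proof.
move=> hZ uZ; rewrite map_inj_in_uniq ?filter_uniq // => x y.
rewrite !mem_filter => /andP[/eqP hx /hZ sx] /andP[/eqP hy /hZ sy].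
by case: x y hx hy sx sy => [|a x] [|b y] //= -> -> _ _ ->.
Qed.

Lemma size_layers n c Z : (forall z, z \in Z -> size z = n.+1 /\ all (ltn^~ c) z) ->
  size Z = (\sum_(j < c) size (layer Z j))%N.
Proof.
elim: Z => [|z Z IH] hZ; first by rewrite big1 // => i _.
have [|sz az] := hZ z; first by rewrite inE eqxx.
have hz : (head 0 z < c)%N by case: z sz az {hZ} => //= a z _ /andP[].
rewrite /= IH => [|x hx]; last by apply: hZ; rewrite inE hx orbT.
rewrite (bigD1 (Ordinal hz)) //= [in RHS](bigD1 (Ordinal hz)) //=.
rewrite /layer /= eqxx /= addSn; congr (_ + _).+1.
by apply: eq_bigr => i /eqP hi; case: eqP => // hh; case: hi; apply: val_inj.
Qed.

Lemma mem_layer n c Z : (forall z, z \in Z -> size z = n.+1 /\ all (ltn^~ c) z) ->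
  forall j z, z \in layer Z j -> [/\ size z = n, all (ltn^~ c) z & j :: z \in Z].
Proof.
move=> hZ j z /mapP[x]; rewrite mem_filter => /andP[/eqP hx xZ] ->.
have [] := hZ x xZ; case: x xZ hx => //= a x xZ <- [sx] /andP[_ ax].
by split.
Qed.

Lemma size_grid n c Z : uniq Z ->
  (forall z, z \in Z -> size z = n /\ all (ltn^~ c) z) -> (size Z <= c ^ n)%N.
Proof.
elim: n Z => [|n IH] Z uZ hZ.
  case: Z uZ hZ => [|x [|y Z]] //= /andP[xy _] hZ.
  have [/size0nil x0 _] := hZ x (mem_head _ _).
  have [|/size0nil y0 _] := hZ y; first by rewrite !inE eqxx /= orbT.
  by rewrite x0 y0 !inE eqxx in xy.
rewrite (size_layers hZ) expnS.
rewrite -[X in (_ <= X * _)%N]card_ord -sum_nat_const; apply: leq_sum => j _.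
apply: IH; first by apply: (@layer_uniq n) => // z /hZ[].
by move=> z /(mem_layer hZ)[].
Qed.

Lemma vanishes_to_nvar0 (v : 'I_0 -> K) m f : f != 0 -> vanishes_to v m f -> m = 0%N.
Proof.
move=> f0; rewrite (nvar0_mpolyC f) /vanishes_to line_expansionC; case: m => // m.
move=> /(_ 0%N isT) /eqP; rewrite coefC eqxx mpolyC_eq0 => /eqP fc.
by rewrite (nvar0_mpolyC f) fc mpolyC0 eqxx in f0.
Qed.

(** In dimension n + 1, let e_j be the multiplicity of x_0 = j in f, and d' the degree of
    the quotient g, so that d' plus the sum of the e_j is at most d.  On this
    hyperplane, g restricts to a nonzero polynomial vanishing to order m - e_j at
    the points of the layer Z_j, hence by induction
    |Z_j| c (m - e_j) <= c^n d'.  Since |Z_j| c <= c^(n+1), also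
    |Z_j| c m <= c^n d' + c^(n+1) e_j, and summing over the c layers gives the
    claim.  The spare factor c makes n = 0 meaningful. *)
Lemma multiplicity_schwartz_zippel n c d m Z (f : {mpoly K[n]}) :
  f != 0 -> (msize f <= d.+1)%N -> uniq Z ->
  (forall z, z \in Z -> size z = n /\ all (ltn^~ c) z) ->
  (forall z, z \in Z -> vanishes_to (lattice_point z) m f) ->
  (size Z * c * m <= c ^ n * d)%N.
Proof.
elim: n d m Z f => [|n IH] d m Z f f0 fd uZ hZ vZ.
  have := size_grid uZ hZ; case: Z uZ hZ vZ => [|z [|y Z]] //= _ _ vZ _.
  by rewrite (vanishes_to_nvar0 f0 (vZ z (mem_head _ _))) muln0.
have [e [g [gr gs g0 gv]]] := strip_hyperplanes (iota_uniq 0 c) f0.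
pose d' := (msize g).-1.
have gS : msize g = d'.+1 by rewrite /d' prednK // lt0n msize_poly_eq0.
have hd' : (\sum_(j < c) e j + d' <= d)%N.
  by rewrite -(big_mkord xpredT) /index_iota subn0 -ltnS -addnS -gS gs.
have hj (j : 'I_c) : (size (layer Z j) * c * m <= c ^ n * d' + c ^ n.+1 * e j)%N.
  have uL : uniq (layer Z j) by apply: (@layer_uniq n) => // z /hZ[].
  have gj : slice (j : nat)%:R g != 0 by apply: gr; rewrite mem_iota /=.
  have mj : (msize (slice (j : nat)%:R g) <= d'.+1)%N by rewrite -gS msize_slice.
  have hL z : z \in layer Z j -> size z = n /\ all (ltn^~ c) z.
    by move=> /(mem_layer hZ)[].
  have vL z : z \in layer Z j ->
      vanishes_to (lattice_point z) (m - e j) (slice (j : nat)%:R g).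
    move=> /(mem_layer hZ)[_ _ /vZ zv].
    by have := vanishes_to_slice (gv _ _ _ erefl zv); rewrite lattice_point_behead.
  have h1 := IH _ _ _ _ gj mj uL hL vL.
  have h2 : (size (layer Z j) * c <= c ^ n.+1)%N.
    by rewrite expnSr leq_mul2r size_grid ?orbT.
  have h3 : (m <= m - e j + e j)%N by lia.
  apply: leq_trans (leq_mul (leqnn _) h3) _.
  by rewrite mulnDr leq_add // leq_mul2r h2 orbT.
rewrite (size_layers hZ) !big_distrl /=.
apply: (@leq_trans (\sum_(j < c) (c ^ n * d' + c ^ n.+1 * e j))).
  by apply: leq_sum => j _; apply: hj.
rewrite big_split /= sum_nat_const card_ord mulnA -expnS -big_distrr /= -mulnDr.
by rewrite addnC leq_mul2l hd' orbT.
Qed.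

(** The points with z_0 = 0 form a simplex of dimension n - 1 and size s, those with
    z_0 > 0 a translate of the simplex of dimension n and size s - 1.  Let e be
    the multiplicity in f of the hyperplane of the former, and d' the degree of
    the quotient: the former simplex bounds d' below in terms of m - e, the latter,
    which is off the hyperplane, in terms of m.  The base point u absorbs the
    translations. *)
Lemma simplex_bound n s d m (u : 'I_n -> K) (f : {mpoly K[n]}) :
  f != 0 -> (msize f <= d.+1)%N ->
  (forall z, size z = n -> (sumn z <= s)%N ->
     vanishes_to (fun i => u i + lattice_point z i) m f) ->
  ((n + s) * m <= n * d)%N.
Proof.
have [k] := ubnP (n + s); elim: k n s d m u f => // k IH [|n] s d m u f hk f0 fd vf.
  by rewrite (vanishes_to_nvar0 f0 (vf [::] erefl (leq0n _))) muln0.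
have [e [g [gE gr]]] := strip_hyperplane (u ord0) f0.
have g0 := slice_neq0 gr.
pose d' := (msize g).-1.
have gS : msize g = d'.+1 by rewrite /d' prednK // lt0n msize_poly_eq0.
have hd' : (e + d' <= d)%N by rewrite -ltnS -addnS -gS -(msize_strip (u ord0)) // -gE.
have vg z : size z = n -> (sumn z <= s)%N ->
    vanishes_to (fun i => (u \o lift ord0) i + lattice_point z i) (m - e)
                (slice (u ord0) g).
  move=> sz zs; pose v (i : 'I_n.+1) := u i + lattice_point (0%N :: z) i.
  have v0 : v ord0 = u ord0 by rewrite /v /lattice_point /= mulr0n addr0.
  have vE : v \o lift ord0 = fun i => (u \o lift ord0) i + lattice_point z i.
    by apply/funext.
  have vfz : vanishes_to v m f by apply: vf; rewrite //= sz.
  rewrite -vE -v0; apply: vanishes_to_slice; apply: vanishes_to_strip_on.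
  by rewrite v0 -gE.
have h1 : ((n + s) * (m - e) <= n * d')%N.
  have hk' : (n + s < k)%N by rewrite -ltnS -addSn.
  have mr : (msize (slice (u ord0) g) <= d'.+1)%N by rewrite -gS msize_slice.
  exact: IH n s d' (m - e)%N (u \o lift ord0) _ hk' gr mr vg.
case: s => [|s] in hk vf vg h1 *.
  (* A single point: in dimension 1 the restricted polynomial is a constant. *)
  rewrite addn0 leq_mul2l; case: n => [|n] in u f g gE gr g0 d' gS hd' vf vg f0 fd h1 hk *.
    by have := vanishes_to_nvar0 gr (vg [::] erefl isT); lia.
  by move: h1; rewrite addn0 leq_mul2l /=; lia.
have h2 : ((n.+1 + s) * m <= n.+1 * d')%N.
  have hk' : (n.+1 + s < k)%N by rewrite -ltnS -addnS.
  have mg : (msize g <= d'.+1)%N by rewrite gS.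
  apply: (IH n.+1 s d' m (fun i => u i + (i == ord0)%:R) g hk' g0 mg).
  case=> [|a z] //= sz zs; pose v (i : 'I_n.+1) := u i + lattice_point (a.+1 :: z) i.
  have vE : v = fun i => u i + (i == ord0)%:R + lattice_point (a :: z) i.
    apply/funext => i; rewrite /v /lattice_point; case: (unliftP ord0 i) => [j|] -> /=.
      by rewrite addr0.
    by rewrite -addrA -natr1 [1 + _]addrC.
  have vfz : vanishes_to v m f by apply: vf => //=; rewrite sz.
  rewrite -vE; apply: (@vanishes_to_strip_off _ v (u ord0) e); last by rewrite -gE.
  by rewrite /v /lattice_point /= -subr_eq0 addrAC subrr add0r pnatr_eq0.
(* The two bounds are combined with weights n.+1 and s.+1, which eliminates e. *)
rewrite -(@leq_pmul2l (n + s.+1)); last by rewrite addnS.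
have h3 : (m <= m - e + e)%N by lia.
have h4 := leq_mul (leqnn (n.+1 * (n + s.+1))%N) h3.
have h5 := leq_mul (leqnn n.+1) h1.
have h6 := leq_mul (leqnn s.+1) h2.
have h7 := leq_mul (leqnn ((n + s.+1) * n.+1)%N) hd'.
move: (m - e)%N h4 h5 h6 h7 {h1 h2 h3} => x h4 h5 h6 h7.
clear - h4 h5 h6 h7; nia.
Qed.
End Lines.

(** * Tuples of points through which no form passes *)

Section Special.
Variable K : numFieldType.

(** In a fixed degree, a monomial is determined by its exponents in the variables
    other than the first, so no cancellation can occur. *)
Lemma dehomogenize_neq0 n d (f : {mpoly K[n.+1]}) :
  f \is d.-homog -> f != 0 -> slice 1 f != 0.
Proof.
move=> fd f0.
pose tail (a : 'X_{1..n.+1}) : 'X_{1..n} := [multinom a (lift ord0 i) | i < n].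
have aE (a : 'X_{1..n.+1}) : mdeg a = (a ord0 + mdeg (tail a))%N.
  by rewrite !mdegE big_ord_recl; congr addn; apply: eq_bigr => i _; rewrite mnmE.
have rE : slice 1 f = \sum_(a <- msupp f) f@_a *: 'X_[tail a].
  rewrite /slice /mmap; apply: eq_bigr => a _; rewrite mul_mpolyC; congr (_ *: _).
  rewrite /mmap1 big_ord_recl unlift_none mpolyC1 expr1n mul1r mpolyXE_id.
  by apply: eq_bigr => i _; rewrite liftK mnmE.
have a0 := mlead_supp f0; set a := mlead f in a0.
apply/eqP => /(congr1 (mcoeff (tail a))); rewrite rE raddf_sum /= mcoeff0.
rewrite (bigD1_seq a) ?msupp_uniq //= mcoeffZ mcoeffX eqxx mulr1 big_seq_cond big1.
  by move/eqP; rewrite addr0 mcoeff_eq0 a0.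
move=> b /andP[bf ba]; rewrite mcoeffZ mcoeffX; case: eqP => [tE|]; last by rewrite mulr0.
case/eqP: ba; apply/mnmP => i; case: (unliftP ord0 i) => [j|] ->.
  by have := congr1 (fun t : 'X_{1..n} => t j) tE; rewrite !mnmE.
have ab : mdeg b = mdeg a := etrans (dhomog_mf fd bf) (esym (dhomog_mf fd a0)).
move/eqP: ab; rewrite !aE tE.
by rewrite eqn_add2r => /eqP.
Qed.

Lemma dhomog_msize_leq n d (f : {mpoly K[n]}) : f \is d.-homog -> (msize f <= d.+1)%N.
Proof.
by move=> fd; rewrite msizeE; apply/bigmax_leqP_seq => a ha _; rewrite (dhomog_mf fd ha).
Qed.

(** The rows of A are homogeneous coordinates of points that impose independent
    enough conditions to leave no form of degree d with multiplicity m. *)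
Definition isolating_tuple r N d m :=
  exists A : 'M[K]_(r, N.+1), (forall i, row i A != 0) /\
    forall f : {mpoly K[N.+1]}, f \is d.-homog ->
      (forall i, vanishes_to (A i) m f) -> f = 0.

(** Points are placed in the chart x_0 = 1; when r exceeds the number of points of Z,
    the remaining ones are arbitrary. *)
Lemma isolating_lattice r N d m (Z : seq (seq nat)) : (size Z <= r)%N ->
  (forall f : {mpoly K[N]}, (msize f <= d.+1)%N ->
     (forall z, z \in Z -> vanishes_to (lattice_point K z) m f) -> f = 0) ->
  isolating_tuple r N d m.
Proof.
move=> Zr hZ.
pose A := \matrix_(i < r, j < N.+1) @lattice_point K N.+1 (1%N :: nth [::] Z i) j.
have A0 i : A i ord0 = 1 by rewrite mxE.
exists A; split=> [i|f fd vf].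
  apply/eqP => /rowP /(_ ord0) /eqP; rewrite [row i A ord0 ord0]mxE A0.
  by rewrite [X in _ == X]mxE oner_eq0.
apply/eqP; apply: contraT => /(dehomogenize_neq0 fd) /negP; case; apply/eqP.
apply: hZ; first by rewrite (leq_trans (msize_slice _ _)) // dhomog_msize_leq.
move=> z zZ; have zr : (index z Z < r)%N by rewrite (leq_trans _ Zr) // index_mem.
have := vanishes_to_slice (vf (Ordinal zr)); rewrite A0.
have -> // : A (Ordinal zr) \o lift ord0 = lattice_point K z.
by apply/funext => i; rewrite /= mxE /= nth_index.
Qed.

Lemma isolating_grid r N c d m :
  (c ^ N * d < minn r (c ^ N) * c * m)%N -> isolating_tuple r N d m.
Proof.
move=> h; pose G := [seq map val (val t) | t <- enum {: N.-tuple 'I_c}].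
have uG : uniq G.
  rewrite map_inj_uniq ?enum_uniq // => s t /(inj_map val_inj) /val_inj //.
have sG : size G = (c ^ N)%N by rewrite size_map -cardE card_tuple card_ord.
apply: (@isolating_lattice r N d m (take r G)); first by rewrite size_take sG; case: ltnP.
move=> f fd vf; apply/eqP; apply: contraLR h => f0; rewrite -leqNgt.
have <- : size (take r G) = minn r (c ^ N) by rewrite size_take sG minnC /minn; case: ltngtP.
apply: multiplicity_schwartz_zippel vf => //; first exact: take_uniq.
move=> z /mem_take /mapP[t _ ->]; split; first by rewrite size_map size_tuple.
by rewrite all_map; apply/allP => i _ /=.
Qed.

Lemma isolating_simplex r N s d m : ('C(N + s, N) <= r)%N ->
  (N * d < (N + s) * m)%N -> isolating_tuple r N d m.
Proof.
move=> hr h.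
pose S := [set t : N.-tuple 'I_s.+1 | (\sum_(i <- t) i <= s)%N]%SET.
pose Z := [seq map val (val t) | t <- enum S].
apply: (@isolating_lattice r N d m Z).
  by rewrite size_map -cardE card_partial_ord_partitions.
move=> f fd vf; apply/eqP; apply: contraLR h => f0; rewrite -leqNgt.
apply: (@simplex_bound K N s d m (fun=> 0) f f0 fd) => z zN zs.
have -> : (fun i => 0 + lattice_point K z i) = @lattice_point K N z.
  by apply/funext => i; rewrite add0r.
apply: vf; apply/mapP.
have zb : all (fun x => x < s.+1)%N z.
  apply/allP => x xz; rewrite ltnS; apply: leq_trans zs.
  by rewrite sumnE (big_rem x xz) /= leq_addr.
have zt : size [seq inord x : 'I_s.+1 | x <- z] == N by rewrite size_map zN.
have zE : z = [seq val i | i <- [seq inord x : 'I_s.+1 | x <- z]].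
  rewrite -map_comp -[LHS]map_id; apply/eq_in_map => x /(allP zb) xs /=.
  by rewrite inordK.
exists (Tuple zt) => //; rewrite mem_enum inE /=.
by move: zs; rewrite sumnE {1}zE big_map.
Qed.
End Special.

(** * Avoiding forms is a very general condition *)

Definition monomials n d : seq (multinom n) :=
  [seq s2m (t : d.-tuple _) | t <- enum (basis n d)].

Lemma mem_monomials n d (a : 'X_{1..n}) : (a \in monomials n d) = (mdeg a == d).
Proof. by rewrite basis_cover. Qed.

Section Forms.
Variables (K : fieldType) (n d : nat).

Lemma dhomogE_monomials (f : {mpoly K[n]}) : f \is d.-homog ->
  f = \sum_(a <- monomials n d) f@_a *: 'X_[a].
Proof.
move=> fd; apply/mpolyP => c; rewrite raddf_sum /=.
have [cd|cd] := eqVneq (mdeg c) d; last first.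
  rewrite (dhomog_nemf_coeff fd) // big1_seq // => a /andP[_].
  rewrite mem_monomials => /eqP ad.
  by rewrite mcoeffZ mcoeffX; case: eqP => [ac|]; rewrite ?mulr0 // -ac ad eqxx in cd *.
rewrite (bigD1_seq c) ?uniq_basis ?mem_monomials ?cd //= mcoeffZ mcoeffX eqxx mulr1.
rewrite big1 ?addr0 // => a ac; rewrite mcoeffZ mcoeffX (negbTE ac) mulr0 //.
Qed.

Lemma form_of_coefs (u : 'I_(size (monomials n d)) -> K) :
  exists2 f : {mpoly K[n]}, f \is d.-homog &
    forall a : 'I_(size (monomials n d)), f@_(nth 0%MM (monomials n d) a) = u a.
Proof.
exists (\sum_a u a *: 'X_[nth 0%MM (monomials n d) a]) => [|a].
  apply: rpred_sum => a _; apply: rpredZ; rewrite dhomogX.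
  by rewrite -[_ == _]mem_monomials mem_nth.
rewrite raddf_sum (bigD1 a) //= mcoeffZ mcoeffX eqxx mulr1 big1 ?addr0 // => b ba.
rewrite mcoeffZ mcoeffX nth_uniq ?uniq_basis ?ltn_ord //.
by move: ba; rewrite -val_eqE /= => /negbTE ->; rewrite mulr0.
Qed.
End Forms.

(** The coefficient of h^b in (v + h)^a.  The coefficient ring is arbitrary because v
    is used both as a point and as a tuple of indeterminates. *)
Definition taylor_coef (B : comNzRingType) n d (a : 'X_{1..n})
    (b : {ffun 'I_n -> 'I_d.+1}) (v : 'I_n -> B) : B :=
  \prod_k (v k ^+ (a k - b k) *+ 'C(a k, b k)).

Lemma rmorph_taylor_coef (B C : comNzRingType) (phi : {rmorphism B -> C}) n d
    (a : 'X_{1..n}) (b : {ffun 'I_n -> 'I_d.+1}) (v : 'I_n -> B) :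
  phi (taylor_coef a b v) = taylor_coef a b (phi \o v).
Proof.
by rewrite rmorph_prod; apply: eq_bigr => k _; rewrite rmorphMn rmorphXn.
Qed.

Section Taylor.
Variable K : numFieldType.

Lemma line_expansion_monomial n d (a : 'X_{1..n}) (v : 'I_n -> K) :
  (forall k, (a k <= d)%N) ->
  line_expansion v 'X_[a] = \sum_(b : {ffun 'I_n -> 'I_d.+1})
    (taylor_coef a b v *: 'X_[[multinom (b k : nat) | k < n]])%:P * 'X^(\sum_k b k)%N.
Proof.
move=> ad; rewrite mpolyXE_id rmorph_prod.
transitivity (\prod_k \sum_(j < d.+1)
   ((v k ^+ (a k - j) *+ 'C(a k, j)) *: 'X_k ^+ j)%:P * 'X^j : {poly {mpoly K[n]}}).
  apply: eq_bigr => k _; rewrite rmorphXn /= line_expansionX exprDn.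
  rewrite (big_ord_widen d.+1 (fun j => ((v k)%:MP%:P : {poly {mpoly K[n]}}) ^+ (a k - j)
     * (('X_k)%:P * 'X) ^+ j *+ 'C(a k, j))) ?ltnS //.
  rewrite big_mkcond; apply: eq_bigr => j _; case: ifP => [ja|]; last first.
    by rewrite ltnS leqNgt => /negbFE ja; rewrite bin_small // mulr0n scale0r polyC0 mul0r.
  rewrite exprMn -!rmorphXn -mulrnAl mulrA -rmorphMn; congr (_ * _).
  by rewrite -[in RHS]mul_mpolyC [in RHS]polyCM -rmorphMn /=.
rewrite bigA_distr_bigA; apply: eq_bigr => b _.
rewrite big_split /= prodrXr -rmorph_prod; congr (_%:P * _).
by rewrite scaler_prod mpolyXE_id; congr (_ *: _); apply: eq_bigr => k _; rewrite mnmE.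
Qed.

(** For forms of degree d, vanishing to order m at v is a system of linear equations
    in the coefficients, whose matrix entries are monomials in v. *)
Lemma vanishes_to_linear n d m (v : 'I_n -> K) (f : {mpoly K[n]}) : f \is d.-homog ->
  vanishes_to v m f <->
  forall b : {ffun 'I_n -> 'I_d.+1}, (\sum_k b k < m)%N ->
    \sum_(a <- monomials n d) f@_a * taylor_coef a b v = 0.
Proof.
move=> fd.
pose C (b : {ffun 'I_n -> 'I_d.+1}) := \sum_(a <- monomials n d) f@_a * taylor_coef a b v.
have E : line_expansion v f = \sum_(b : {ffun 'I_n -> 'I_d.+1})
    (C b *: 'X_[[multinom (b k : nat) | k < n]])%:P * 'X^(\sum_k b k)%N.
  rewrite {1}(dhomogE_monomials fd) rmorph_sum big_seq.
  under eq_bigr => a ha.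
    rewrite -mul_mpolyC rmorphM /= line_expansionC (@line_expansion_monomial _ d); last first.
      move: ha; rewrite mem_monomials mdegE => /eqP <- k.
      by rewrite (bigD1 k) //= leq_addr.
    rewrite mulr_sumr.
  over.
  rewrite -big_seq exchange_big /=; apply: eq_bigr => b _.
  under eq_bigr => a _ do rewrite mulrA.
  rewrite -mulr_suml; congr (_ * _); rewrite scaler_suml rmorph_sum.
  apply: eq_bigr => a _.
  by rewrite -polyCM mul_mpolyC scalerA.
have cE j : (line_expansion v f)`_j =
    \sum_(b : {ffun 'I_n -> 'I_d.+1} | (\sum_k b k == j)%N)
    C b *: 'X_[[multinom (b k : nat) | k < n]].
  rewrite E coef_sum [RHS]big_mkcond; apply: eq_bigr => b _.
  by rewrite coefCM coefXn eq_sym; case: eqP; rewrite ?mulr1 ?mulr0.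
split=> [h b bm|h j jm]; last first.
  by rewrite cE big1 // => b /eqP bj; rewrite /C h ?scale0r // bj.
have := h _ bm; rewrite cE => /(congr1 (mcoeff [multinom (b k : nat) | k < n])).
rewrite raddf_sum /= mcoeff0 (bigD1 b) //= mcoeffZ mcoeffX eqxx mulr1 big1 ?addr0 //.
move=> c /andP[_ cb]; rewrite mcoeffZ mcoeffX; case: eqP => [e|]; last by rewrite mulr0.
case/eqP: cb; apply/ffunP => k; apply: val_inj.
by have := congr1 (fun t : 'X_{1..n} => t k) e; rewrite !mnmE.
Qed.
End Taylor.

Section Multihomogeneous.
Variables (K : fieldType) (N r : nat).
Implicit Types (f g : {mpoly K[r * N.+1]}) (d e : 'I_r -> nat).

Lemma multihomog0 d : @is_multihomog K N r d 0.
Proof. by move=> mon; rewrite msupp0. Qed.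

Lemma multihomogC c : @is_multihomog K N r (fun=> 0%N) c%:MP.
Proof.
move=> mon; rewrite msuppC; case: ifP => // _; rewrite inE => /eqP -> i.
by rewrite big1 // => j _; rewrite mnm0E.
Qed.

Lemma multihomogD d f g : is_multihomog d f -> is_multihomog d g ->
  is_multihomog d (f + g).
Proof. by move=> hf hg mon /msuppD_le; rewrite mem_cat => /orP[/hf|/hg]. Qed.

Lemma multihomogM d e f g : is_multihomog d f -> is_multihomog e g ->
  is_multihomog (fun i => d i + e i)%N (f * g).
Proof.
move=> hf hg mon /msuppM_le /allpairsP[[a b] /= [/hf af /hg bg ->]] i.
by rewrite -af -bg -big_split; apply: eq_bigr => j _; rewrite mnmDE.
Qed.

Lemma eq_multihomog d e f : d =1 e -> is_multihomog d f -> is_multihomog e f.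
Proof. by move=> de h mon /h H i; rewrite H. Qed.

Lemma multihomog_prod (I : Type) (s : seq I) (F : I -> {mpoly K[r * N.+1]})
    (d : I -> 'I_r -> nat) :
  (forall k, is_multihomog (d k) (F k)) ->
  is_multihomog (fun i => \sum_(k <- s) d k i)%N (\prod_(k <- s) F k).
Proof.
move=> h; elim: s => [|k s IH].
  rewrite big_nil -mpolyC1; apply: (@eq_multihomog (fun=> 0%N)); last exact: multihomogC.
  by move=> i; rewrite big_nil.
rewrite big_cons; apply: (@eq_multihomog (fun i => d k i + \sum_(l <- s) d l i)%N).
  by move=> i; rewrite big_cons.
exact: multihomogM.
Qed.

Lemma multihomog_sum (I : Type) (s : seq I) (P : pred I)
    (F : I -> {mpoly K[r * N.+1]}) d :
  (forall k, P k -> is_multihomog d (F k)) -> is_multihomog d (\sum_(k <- s | P k) F k).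
Proof. by move=> h; apply: big_ind => //; [apply: multihomog0|exact: multihomogD]. Qed.

Lemma mxvec_index_eq (i i' : 'I_r) (j j' : 'I_N.+1) :
  (mxvec_index i j == mxvec_index i' j') = (i == i') && (j == j').
Proof.
apply/eqP/andP => [h|[/eqP -> /eqP ->]] //.
have [g gK _] := curry_mxvec_bij r N.+1.
have := gK (i, j) isT; rewrite /= h => h1; have := gK (i', j') isT; rewrite /= h1.
by case=> -> ->.
Qed.

Lemma multihomogX (i : 'I_r) (k : 'I_N.+1) (q : nat) :
  is_multihomog (fun i' => (i == i') * q)%N
    ('X_(mxvec_index i k) ^+ q : {mpoly K[r * N.+1]}).
Proof.
move=> mon; rewrite mpolyXn msuppX inE => /eqP -> i'.
rewrite (bigD1 k) //= big1 => [|j jk].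
  by rewrite mulmnE mnm1E mxvec_index_eq eqxx andbT addn0.
by rewrite mulmnE mnm1E mxvec_index_eq [k == j]eq_sym (negbTE jk) andbF.
Qed.

Lemma multihomogMn d f k : is_multihomog d f -> is_multihomog d (f *+ k).
Proof. by move=> h mon; rewrite -scaler_nat => /msuppZ_le /h. Qed.

(** Either b <= a componentwise and this is a multiple of a monomial of degree n - |b|
    in the coordinates of the i-th point, or a binomial coefficient vanishes. *)
Lemma multihomog_taylor_coef n (i : 'I_r) (a : 'X_{1..N.+1})
    (b : {ffun 'I_N.+1 -> 'I_n.+1}) :
  mdeg a = n ->
  is_multihomog (fun i' => (i == i') * (n - \sum_k b k))%N
    (taylor_coef a b (fun k => 'X_(mxvec_index i k) : {mpoly K[r * N.+1]})).
Proof.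
move=> an; have [ba|] := boolP [forall k, (b k <= a k)%N]; last first.
  rewrite negb_forall => /existsP[k]; rewrite -ltnNge => abk.
  have -> : taylor_coef a b (fun k => 'X_(mxvec_index i k) : {mpoly K[r * N.+1]}) = 0.
    by rewrite /taylor_coef (bigD1 k) //= bin_small // mulr0n mul0r.
  exact: multihomog0.
move/forallP in ba.
apply: (@eq_multihomog (fun i' => \sum_k (i == i') * (a k - b k))%N).
  by move=> i'; rewrite -big_distrr /= sumnB // -mdegE an.
by apply: multihomog_prod => k; apply: multihomogMn; apply: multihomogX.
Qed.

(** In every term of the determinant each row contributes its own multidegree, so
    only the rows need to have well defined multidegrees. *)
Lemma multihomog_det n (M : 'M[{mpoly K[r * N.+1]}]_n) (D : 'I_n -> 'I_r -> nat) :
  (forall k l, is_multihomog (D k) (M k l)) ->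
  is_multihomog (fun i => \sum_k D k i)%N (\det M).
Proof.
move=> hM; apply: multihomog_sum => s _.
have -> : (-1) ^+ perm.odd_perm s = ((-1) ^+ perm.odd_perm s)%:MP :> {mpoly K[r * N.+1]}.
  by rewrite rmorphXn rmorphN1.
apply: (@eq_multihomog (fun i => 0 + \sum_k D k i)%N); first by move=> i.
by apply: multihomogM; [apply: multihomogC|apply: multihomog_prod].
Qed.
End Multihomogeneous.

Section VeryGeneral.
Variable K : numFieldType.

Lemma order_ge_prod (A : idomainType) m (F : 'I_m -> {poly A}) :
  (forall i, order_ge 1 (F i)) -> order_ge m (\prod_i F i).
Proof.
elim: m F => [|m IH] F hF //; rewrite big_ord_recl.
by apply: (@order_ge_mul _ 1 m) => //; apply: IH.
Qed.

Lemma line_expansion0 n (v : 'I_n -> K) f : (line_expansion v f)`_0 = f.@[v]%:MP.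
Proof.
apply: (@eq_mpoly_rmorphism K {mpoly K[n]} n
  (coefp 0 \o @line_expansion K n v) (@mpolyC n K \o @meval n K v)) => [c|i] /=.
  by rewrite line_expansionC /coefp coefC mevalC.
by rewrite line_expansionX /coefp coefD coefC coefMX addr0 mevalXU.
Qed.


Lemma exists_represents (n : nat) (v : 'rV[K]_n.+1) : v != 0 ->
  exists P : proj_space K n, represents v P.
Proof.
move=> v0; have d1 : \dim <[v]>%VS == 1%N by rewrite dim_vline v0.
by exists (exist _ <[v]>%VS d1); split => //=; apply: memv_line.
Qed.

(** A form vanishing at P has no constant term along a line through P, so a product
    of m of them is divisible by T^m. *)
Lemma ideal_pow_vanishes_to N (P : proj_space K N) v m f :
  represents v P -> ideal_pow (point_ideal P) m f -> vanishes_to (v ord0) m f.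
Proof.
move=> vP [k [a [s [hs ->]]]].
rewrite /vanishes_to rmorph_sum /= => j jm; rewrite coef_sum big1 // => i _.
have [g [hg ->]] := hs i; rewrite rmorphM rmorph_prod /=.
apply: (@order_ge_mul _ 0 m) => //; apply: order_ge_prod => l [] // _.
have [k' [a' [s' [hs' ->]]]] := hg l.
rewrite rmorph_sum /= coef_sum big1 // => i' _; rewrite rmorphM /= coef0M.
have [_ /(_ v vP) sv] := hs' i'.
have z := line_expansion0 (v ord0) (s' i').
rewrite sv in z.
rewrite mpolyC0 in z.
exact: etrans (congr1 (fun y => (line_expansion (v ord0) (a' i'))`_0 * y) z) (mulr0 _).
Qed.

(** The vanishing conditions of order m at the points form a matrix with entries
    multihomogeneous in the coordinates of the points.  At an isolating tuple it
    is injective on forms of degree d, so one of its maximal minors Delta is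
    nonzero there; and wherever Delta is nonzero the only form of degree d in the
    symbolic power is 0. *)
Lemma isolating_very_general r N d m : isolating_tuple K r N d m ->
  exists W : set ('I_r -> proj_space K N), [/\ is_closed W, W <> setT &
    forall p, ~ W p -> ~ has_form (symbolic_power (range p) m) d].
Proof.
move=> [A0 [A00 hA0]].
pose T : finType := ('I_r * {ffun 'I_N.+1 -> 'I_d.+1})%type.
pose s := size (monomials N.+1 d).
pose mon (a : 'I_s) := nth 0%MM (monomials N.+1 d) a.
pose entry (B : comNzRingType) (v : 'I_r -> 'I_N.+1 -> B)
    (t : 'I_#|T|) (a : 'I_s) : B :=
  let: (i, b) := (enum_val t : T) in
  if (\sum_k b k < m)%N then taylor_coef (mon a) b (v i) else 0.
have entryE (A : 'M[K]_(r, N.+1)) f : f \is d.-homog ->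
    (forall i, vanishes_to (A i) m f) <->
    (\matrix_(t, a) entry K A t a) *m (\col_a f@_(mon a)) = 0.
  move=> fd.
  have rowE t : ((\matrix_(t, a) entry K A t a) *m (\col_a f@_(mon a))) t ord0 =
      if (\sum_k (enum_val t : T).2 k < m)%N then
        \sum_(a <- monomials N.+1 d)
          f@_a * taylor_coef a (enum_val t : T).2 (A (enum_val t : T).1)
      else 0.
    rewrite mxE (big_nth 0%MM) big_mkord; case: ifP => h; last first.
      rewrite big1 // => a _; rewrite !mxE /entry.
      by case: (enum_val t) h => i b /= ->; rewrite mul0r.
    apply: eq_bigr => a _; rewrite !mxE /entry; case: (enum_val t) h => i b /= ->.
    by rewrite mulrC.
  split=> [h|h i].
    apply/colP => t; rewrite rowE [RHS]mxE; case: ifP => // tm.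
    by move/(vanishes_to_linear _ _ fd): (h (enum_val t : T).1) => ->.
  apply/(vanishes_to_linear _ _ fd) => b bm.
  have := rowE (enum_rank ((i, b) : T)); rewrite h mxE enum_rankK /= bm.
  by move<-.
have monE (a : 'I_s) : mdeg (mon a) = d.
  by apply/eqP; rewrite -mem_monomials mem_nth.
have full0 : row_full (\matrix_(t, a) entry K A0 t a).
  rewrite /row_full -mxrank_tr -[_ == _]/(row_free _); apply: inj_row_free => w w0.
  have [f fd fE] := form_of_coefs (w ord0).
  have f0 : f = 0.
    apply: hA0 => // i; move: i; apply/(entryE _ _ fd).
    apply: trmx_inj; rewrite trmx_mul trmx0 -{}[RHS]w0; congr (_ *m _).
    by apply/rowP => a; rewrite !mxE -fE.
  by apply/rowP => a; rewrite -fE f0 mcoeff0 mxE.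
pose fr := fullrankfun full0.
pose G := \matrix_(t, a)
  entry {mpoly K[r * N.+1]} (fun i k => 'X_(mxvec_index i k)) t a.
pose Delta := \det (rowsub fr G).
have DeltaE (A : 'M[K]_(r, N.+1)) :
    Delta.@[mxvec A ord0] = \det (rowsub fr (\matrix_(t, a) entry K A t a)).
  rewrite -det_map_mx; congr (\det _); apply/matrixP => t a; rewrite !mxE /entry.
  case: (enum_val _) => i b; case: ifP => _; last by rewrite rmorph0.
  rewrite rmorph_taylor_coef; apply: eq_bigr => k _ /=.
  by rewrite mevalXU mxvecE.
exists [set p | vanishes_at_tuple Delta p]; split.
- exists [set Delta]; split.
    move=> _ ->; exists (fun i' => \sum_(t < s)
      let: (i, b) := (enum_val (fr t) : T) in (i == i') * (d - \sum_k b k))%N.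
    apply: multihomog_det => t a; rewrite mxE mxE /entry.
    case: (enum_val _) => i b; case: ifP => _; last exact: multihomog0.
    exact: multihomog_taylor_coef.
  by apply/seteqP; split=> [p h _ ->|p h] //; apply: h.
- have hp i : exists P : proj_space K N, represents (row i A0) P by apply: exists_represents.
  move=> WT; pose p0 i := projT1 (cid (hp i)).
  have : [set p | vanishes_at_tuple Delta p] p0 by rewrite WT.
  move=> /(_ A0 (fun i => projT2 (cid (hp i)))) /eqP; rewrite DeltaE; apply/negP.
  by rewrite -unitfE -[_ \is a _]/(_ \in unitmx) -row_full_unit fullrowsub_full.
move=> p Wp [f [fI f0 fd]].
apply: Wp => A Ap; apply/eqP; apply: contraNT f0; rewrite DeltaE => D0.
have /(entryE _ _ fd) h i : vanishes_to (A i) m f.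
  have <- : row i A ord0 = A i by apply/funext => k; rewrite mxE.
  exact: ideal_pow_vanishes_to (Ap i) (fI (p i) (ex_intro2 _ _ i I erefl)).
have {}h : rowsub fr (\matrix_(t, a) entry K A t a) *m (\col_a f@_(mon a)) = 0.
  by rewrite mul_rowsub_mx h; apply/colP => k; rewrite !mxE.
have c0 : \col_a f@_(mon a) = 0.
  rewrite -[LHS]mul1mx
    -(mulVmx (_ : rowsub fr (\matrix_(t, a) entry K A t a) \in unitmx)).
    by rewrite -mulmxA h mulmx0.
  by rewrite unitmxE unitfE.
rewrite (dhomogE_monomials fd) (big_nth 0%MM) big_mkord big1 // => a _.
by have /colP/(_ a) := c0; rewrite !mxE => ->; rewrite scale0r.
Qed.
End VeryGeneral.

(** * Counting conditions *)

Section IdealPowers.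
Variables (K : fieldType) (n : nat).
Implicit Types (S J : set {mpoly K[n]}) (f g : {mpoly K[n]}).

Lemma ideal_gen0 S : ideal_gen S 0.
Proof. by exists 0%N, (fun=> 0), (fun=> 0); split => [[]|]; rewrite ?big_ord0. Qed.

Lemma ideal_gen_incl S f : S f -> ideal_gen S f.
Proof. by move=> Sf; exists 1%N, (fun=> 1), (fun=> f); rewrite big_ord1 mul1r. Qed.

Lemma ideal_genD S f g : ideal_gen S f -> ideal_gen S g -> ideal_gen S (f + g).
Proof.
move=> [k [a [s [hs ->]]]] [l [b [t [ht ->]]]].
exists (k + l)%N, (fun i => match split i with inl j => a j | inr j => b j end),
  (fun i => match split i with inl j => s j | inr j => t j end); split.
  by move=> i; case: (split i).
rewrite big_split_ord /=; congr (_ + _); apply: eq_bigr => i _.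
  by case: splitP => j /=; [move/val_inj -> | move/eqP; have := ltn_ord i; lia].
by case: splitP => j /=; [have := ltn_ord j; lia | move/addnI/val_inj ->].
Qed.

Lemma ideal_genM S f g : ideal_gen S g -> ideal_gen S (f * g).
Proof.
move=> [k [a [s [hs ->]]]]; exists k, (fun i => f * a i), s; split => //.
by rewrite mulr_sumr; apply: eq_bigr => i _; rewrite mulrA.
Qed.

Lemma ideal_gen_sum S (I : eqType) (r : seq I) (F : I -> {mpoly K[n]}) :
  (forall i, i \in r -> ideal_gen S (F i)) -> ideal_gen S (\sum_(i <- r) F i).
Proof.
move=> h; rewrite big_seq; apply: big_ind => //; [exact: ideal_gen0|exact: ideal_genD].
Qed.

Lemma ideal_pow0 J f : ideal_pow J 0 f.
Proof.
rewrite -[f]mulr1; apply: ideal_genM; apply: ideal_gen_incl.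
by exists (fun=> 0); split => [[]|]; rewrite ?big_ord0.
Qed.

Lemma ideal_powS J m f g : J f -> ideal_pow J m g -> ideal_pow J m.+1 (f * g).
Proof.
move=> Jf [k [a [s [hs ->]]]]; rewrite mulr_sumr; apply: ideal_gen_sum => i _.
rewrite mulrCA; apply: ideal_genM; apply: ideal_gen_incl.
have [h [Jh ->]] := hs i.
exists (fun i => if unlift ord0 i is Some j then h j else f); split => [j|].
  by case: (unlift _ _).
by rewrite big_ord_recl unlift_none; congr (_ * _); apply: eq_bigr => j _; rewrite liftK.
Qed.

Lemma ideal_pow_pred J m f : ideal_pow J m.+1 f -> ideal_pow J m f.
Proof.
move=> [k [a [s [hs ->]]]]; apply: ideal_gen_sum => i _; apply: ideal_genM.
have [h [Jh ->]] := hs i; rewrite big_ord_recl; apply: ideal_genM; apply: ideal_gen_incl.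
by exists (h \o lift ord0); split => // j; apply: Jh.
Qed.

Lemma ideal_pow_leq J m l f : (l <= m)%N -> ideal_pow J m f -> ideal_pow J l f.
Proof.
elim: m => [|m IH]; first by rewrite leqn0 => /eqP ->.
by rewrite leq_eqVlt => /orP[/eqP -> //|lm] /ideal_pow_pred; apply: IH.
Qed.

Lemma ideal_powX J m e f g : J f -> ideal_pow J m g -> ideal_pow J (e + m) (f ^+ e * g).
Proof.
move=> Jf Jg; elim: e => [|e IH]; first by rewrite expr0 mul1r.
by rewrite exprS -mulrA addSn; apply: ideal_powS.
Qed.

(** A monomial in linear coordinates centred at a point lies in the power of the point
    ideal given by its degree in the coordinates other than the k-th, the one that
    does not vanish at the point. *)
Lemma ideal_pow_monomial J (k : 'I_n) (y : 'I_n -> {mpoly K[n]}) (a : 'X_{1..n}) :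
  (forall j, j != k -> J (y j)) ->
  ideal_pow J (\sum_(j | j != k) a j) (\prod_j y j ^+ a j).
Proof.
move=> hy; elim: (index_enum _) => [|j s IH]; first by rewrite !big_nil; apply: ideal_pow0.
rewrite !big_cons; case: ifP => jk; last exact: ideal_genM.
by apply: ideal_powX => //; apply: hy.
Qed.
End IdealPowers.

Section DimensionCount.
Variables (K : fieldType) (N : nat).

Lemma dhomog_mmap n k (h : 'I_n -> {mpoly K[k]}) d (f : {mpoly K[n]}) :
  (forall i, h i \is 1.-homog) -> f \is d.-homog -> mmap (@mpolyC k K) h f \is d.-homog.
Proof.
move=> hh fd; rewrite /mmap big_seq; apply: rpred_sum => a /(dhomog_mf fd) <-.
rewrite mul_mpolyC; apply: rpredZ; rewrite /mmap1.
suff : \prod_i h i ^+ a i \is (\sum_i a i)%N.-homog by rewrite -mdegE.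
elim/big_ind2 : _ => [|p a1 q a2|i _]; [exact: dhomog1|exact: dhomogM|].
by have := dhomogMn (a i) (hh i); rewrite mul1n.
Qed.

(** A projective point has a nonzero coordinate, say the k-th, and the others are
    fixed multiples of it. *)
Lemma proj_point_coords (P : proj_space K N) :
  exists (k : 'I_N.+1) (c : 'I_N.+1 -> K),
    forall w, represents w P -> forall j, w ord0 j = c j * w ord0 k.
Proof.
case: P => U /= dU; pose v := vpick U.
have v0 : v != 0 by rewrite vpick0; apply: contraTneq dU => ->; rewrite dimv0.
have [k vk] : exists k, v ord0 k != 0.
  apply/existsP; apply: contraNT v0 => /existsPn h; apply/eqP/rowP => k.
  by rewrite mxE; apply/eqP; rewrite -[_ == _]negbK.
exists k, (fun j => v ord0 j / v ord0 k) => w [_ /= wU] j.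
have : w \in <[v]>%VS.
  suff -> : <[v]>%VS = U by [].
  by apply/eqP; rewrite eqEdim dim_vline v0 (eqP dU) andbT -memvE memv_pick.
by case/vlineP => c ->; rewrite !mxE mulrACA mulVf // mulr1 mulrC.
Qed.

(** The linear change of coordinates that moves the point with x_j = c_j x_k to the
    k-th coordinate point. *)
Definition shear (k : 'I_N.+1) (c : 'I_N.+1 -> K) :
    {mpoly K[N.+1]} -> {mpoly K[N.+1]} :=
  mmap (@mpolyC N.+1 K) (fun j => if j == k then 'X_k else 'X_j + c j *: 'X_k).
HB.instance Definition _ k c := GRing.RMorphism.on (shear k c).

Lemma shearX k c j : shear k c 'X_j = if j == k then 'X_k else 'X_j + c j *: 'X_k.
Proof. by rewrite /shear mmapX mmap1U. Qed.

Lemma shearK k c f : shear k (fun j => - c j) (shear k c f) = f.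
Proof.
apply: (@eq_mpoly_rmorphism K {mpoly K[N.+1]} N.+1
  (shear k (fun j => - c j) \o shear k c) idfun) => [a|j] /=.
  by rewrite /shear !mmapC.
rewrite shearX; case: eqP => [->|/eqP jk]; first by rewrite shearX eqxx.
rewrite rmorphD /= -mul_mpolyC rmorphM /= !shearX eqxx (negbTE jk).
by rewrite {1}/shear mmapC mul_mpolyC scaleNr subrK.
Qed.

Lemma dhomog_shear k c d f : f \is d.-homog -> shear k c f \is d.-homog.
Proof.
apply: dhomog_mmap => j.
have hX i : ('X_i : {mpoly K[N.+1]}) \is 1.-homog by rewrite dhomogX /= mdeg1.
by case: ifP => _; rewrite ?rpredD ?rpredZ.
Qed.

(** Once the point is the k-th coordinate point, its powers are monomial ideals. *)
Lemma shear_ideal_pow (P : proj_space K N) k c m f :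
  (forall w, represents w P -> forall j, w ord0 j = c j * w ord0 k) ->
  (forall a, a \in msupp (shear k c f) -> m <= \sum_(j | j != k) a j)%N ->
  ideal_pow (point_ideal P) m f.
Proof.
move=> hc hf; rewrite -[f](shearK k c) {1}/shear /mmap.
apply: ideal_gen_sum => a /hf ma; apply: ideal_genM.
apply: ideal_pow_leq ma _; apply: ideal_pow_monomial => j jk.
apply: ideal_gen_incl; rewrite (negbTE jk).
have hX i : ('X_i : {mpoly K[N.+1]}) \is 1.-homog by rewrite dhomogX /= mdeg1.
split; first by exists 1%N; rewrite rpredD ?rpredZ.
move=> w /hc hw; rewrite mevalD mevalZ !mevalXU hw mulNr subrr //.
Qed.

(** At each point the conditions are the vanishing of the sheared coefficients of the
    monomials of degree d whose degree outside the k-th variable is at most m.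
    Such a monomial is obtained from one of degree m by changing the exponent of
    the k-th variable (the map lifted below), so there are at most 'C(m + N, m)
    of them. *)
Lemma symbolic_power_has_form r m d (p : 'I_r -> proj_space K N) :
  (r * 'C(m + N, m) < 'C(d + N, d))%N ->
  has_form (symbolic_power (range p) m.+1) d.
Proof.
move=> h.
have /choice[kc hkc] : forall i, exists kc : 'I_N.+1 * ('I_N.+1 -> K),
    forall w, represents w (p i) -> forall j, w ord0 j = kc.2 j * w ord0 kc.1.
  by move=> i; have [k [c kcP]] := proj_point_coords (p i); exists (k, c).
pose R := size (monomials N.+1 d); pose C := size (monomials N.+1 m).
pose mon (a : 'I_R) := nth 0%MM (monomials N.+1 d) a.
pose T : finType := ('I_r * 'I_C)%type.
pose lifted k (b : 'X_{1..N.+1}) : 'X_{1..N.+1} :=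
  [multinom if j == k then (d + b j - m)%N else b j | j < N.+1].
pose M : 'M[K]_(R, #|T|) := \matrix_(a, t) let: (i, b) := (enum_val t : T) in
  (shear (kc i).1 (kc i).2 'X_[mon a])@_(
    lifted (kc i).1 (nth 0%MM (monomials N.+1 m) b)).
have : kermx M != 0.
  rewrite kermx_eq0; apply: contraTN h => fM; rewrite -leqNgt.
  have := rank_leq_col M; rewrite (eqP fM) card_prod !card_ord.
  by rewrite /R /C /monomials !size_basis.
move=> /rowV0Pn[u /sub_kermxP uM u0].
have [f fd fE] := form_of_coefs (u ord0).
exists f; split => //; last first.
  by apply: contraNneq u0 => f0; apply/eqP/rowP => a; rewrite -fE f0 mcoeff0 mxE.
move=> _ [i _ <-]; apply: (shear_ideal_pow (hkc i)) => g gf.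
rewrite ltnNge; apply/negP => gm.
set k := (kc i).1 in gf gm *.
have gd : mdeg g = d := dhomog_mf (dhomog_shear _ _ fd) gf.
have gE : mdeg g = (g k + \sum_(j | j != k) g j)%N by rewrite mdegE (bigD1 k).
pose b : 'X_{1..N.+1} :=
  [multinom if j == k then (m - \sum_(j | j != k) g j)%N else g j | j < N.+1].
have bE : mdeg b = m.
  rewrite mdegE (bigD1 k) //= mnmE eqxx -[RHS](subnK gm); congr addn.
  by apply: eq_bigr => j jk; rewrite mnmE (negbTE jk).
have lb : lifted k b = g.
  apply/mnmP => j; rewrite !mnmE; case: eqP => // ->; lia.
have bC : (index b (monomials N.+1 m) < C)%N by rewrite index_mem mem_monomials bE.
move: gf; rewrite mcoeff_msupp => /negP; apply; apply/eqP.
have /rowP/(_ (enum_rank ((i, Ordinal bC) : T))) := uM; rewrite !mxE => <-.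
rewrite [in LHS](dhomogE_monomials fd) (big_nth 0%MM) big_mkord rmorph_sum raddf_sum /=.
apply: eq_bigr => a _; rewrite fE !mxE enum_rankK /= nth_index ?mem_monomials ?bE // lb.
by rewrite -mul_mpolyC rmorphM /= {1}/shear mmapC mul_mpolyC mcoeffZ.
Qed.
End DimensionCount.

(** * Comparing the two bounds *)

Section Numerics.
Local Open Scope nat_scope.

(** Of the two pairs of factors the right one has the larger mean, which is where
    k >= m >= 2 is used, and the smaller spread, hence the larger product. *)
Lemma paired_factors_leq m n k i i' : 2 <= m <= k -> i + i' = n ->
  (k.+1 * (m + i)) * (k.+1 * (m + i')) <= (k * (m + n.+1) - i) * (k * (m + n.+1) - i').
Proof.
move=> mk; wlog ii' : i i' / i <= i' => [h|].
  case: (leqP i i') => [|/ltnW]; first exact: h.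
  by rewrite addnC => ii' /(h _ _ ii'); rewrite mulnC [X in _ <= X]mulnC.
have [t ->] : exists t, i' = i + t by exists (i' - i); lia.
move: mk => /andP[m2 mk] <-.
have h1 : i + t <= k * (m + (i + (i + t)).+1) by nia.
have [y yE] : exists y, k * (m + (i + (i + t)).+1) = i + t + y.
  by exists (k * (m + (i + (i + t)).+1) - (i + t)); lia.
rewrite yE (_ : i + t + y - i = y + t); last by lia.
rewrite addKn.
(* Twice the means are compared; the spreads are k.+1 * t and t. *)
have AB : k.+1 * (2 * m + 2 * i + t) <= 2 * y + t by nia.
have S1 : (k.+1 * (2 * m + 2 * i + t)) * (k.+1 * (2 * m + 2 * i + t))
    <= (2 * y + t) * (2 * y + t) by apply: leq_mul.
have S2 : t * t <= (k.+1 * t) * (k.+1 * t) by rewrite leq_mul // leq_pmull.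
move: S1 S2; clear; nia.
Qed.

(** The factors with indices i and n - 1 - i are compared together: the inequality
    can fail for a single factor. *)
Lemma ffact_comparison m n k : 2 <= m <= k ->
  k.+1 ^ n * (m + n).-1 ^_ n <= (k * (m + n)) ^_ n.
Proof.
move=> mk; case: n => [|n]; first by rewrite expn0 !ffactn0.
rewrite !ffact_prod addnS /=.
rewrite -[X in _ ^ X]card_ord -prod_nat_const -big_split /=.
have pairing (F : 'I_n.+1 -> nat) :
    \prod_i F i * \prod_i F i = \prod_i (F i * F (rev_ord i)).
  by rewrite big_split /=; congr (_ * _); apply: reindex_inj rev_ord_inj.
rewrite -leq_sqr -!mulnn !pairing; apply: leq_prod => i _ /=.
have iN : i <= n by rewrite -ltnS.
have := @paired_factors_leq m n k (n - i) i mk (subnK iN).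
rewrite subSS (_ : m + n - (n - i) = m + i); last by lia.
by rewrite addnBA // -addnS [X in _ <= X -> _]mulnC.
Qed.
(** Of the falling factorials D (D-1) .. (D-n) and M (M-1) .. (M-n), with M = m + n,
    the leading factors give D / M, and the others are handled by
    [ffact_comparison], for k = (D-1) / M, so that k + 1 is the ceiling of
    D / M. *)
Lemma ratio_bound_of_bin m n D r : 2 <= m -> m * (m + n) < D ->
  'C(D, n.+1) <= r * 'C(m + n, n.+1) ->
  D * (D.-1 %/ (m + n)).+1 ^ n <= r * (m + n).
Proof.
move=> m2 mD hbin; set M := m + n in mD hbin *; set k := D.-1 %/ M.
have M0 : 0 < M by rewrite /M; lia.
have mk : m <= k by rewrite leq_divRL // -ltnS prednK //; lia.
have kD : k * M <= D.-1 by apply: leq_divM.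
have : D ^_ n.+1 <= r * M ^_ n.+1.
  by rewrite -!bin_ffact mulnA leq_mul2r hbin orbT.
rewrite !ffactnS mulnA => hff.
have f0 : 0 < M.-1 ^_ n by rewrite ffact_gt0 /M; lia.
rewrite -(leq_pmul2r f0) -mulnA; apply: leq_trans hff.
rewrite leq_mul2l; apply/orP; right.
have mk2 : 2 <= m <= k by rewrite m2.
apply: leq_trans (ffact_comparison n mk2) _.
rewrite !ffact_prod; apply: leq_prod => i _.
exact: leq_sub2r.
Qed.
End Numerics.

Section InitialDegree.
Variables (K : fieldType) (n : nat).

Lemma initial_degreeP (J : set {mpoly K[n]}) d : has_form J d ->
  has_form J (initial_degree J) /\ (forall e, has_form J e -> (initial_degree J <= e)%N).
Proof.
move=> hd; rewrite /initial_degree; case: pselect => [h|[]]; last by exists d; apply/asboolP.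
case: ex_minnP => k /asboolP hk kmin; split=> // e he; apply: kmin; exact/asboolP.
Qed.
End InitialDegree.

(** The choice of a special configuration.  The number a stands for the initial degree
    of the m-th symbolic power, and the binomial inequality, obtained by counting
    conditions in degree a - 1, is only available for large a. *)
Lemma isolating_tuple_ratio (K : numFieldType) r n m m' d a :
  (1 <= m)%N -> (m ^ n.+1 <= r)%N ->
  (m * (m + n) < a + n -> 'C(a + n, n.+1) <= r * 'C(m + n, n.+1))%N ->
  ((m + n) * d < (a + n) * m')%N -> isolating_tuple K r n.+1 d m'.
Proof.
move=> m1 mr hbin hd; have M0 : (0 < m + n)%N by lia.
case: (leqP (a + n) (m * (m + n))) => [small|/[dup] big /hbin {}hbin].
  apply: (@isolating_grid K r n.+1 m d m'); rewrite (minn_idPr mr) -mulnA ltn_pmul2l.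
    rewrite -(ltn_pmul2l M0) (leq_trans hd) // mulnA [((m + n) * m)%N]mulnC.
    by rewrite leq_mul2r small orbT.
  by rewrite expn_gt0 m1.
have [m2|m2] := leqP 2 m; last first.
  case: m m1 mr hbin hd M0 big m2 => [|[|//]] // _ _ hbin hd _ big _.
  case: a hbin hd big => [|a] hbin hd big; first by lia.
  apply: (@isolating_simplex K r n.+1 a d m'); last by lia.
  by move: hbin; rewrite add1n binn muln1 addSnnS addnC.
have hD := ratio_bound_of_bin m2 big hbin.
set c := ((a + n).-1 %/ (m + n)).+1 in hD.
have Dc : (a + n <= c * (m + n))%N.
  by rewrite -[X in (X <= _)%N]prednK ?ltn_ceil //; lia.
have key : ((a + n) * c ^ n <= minn r (c ^ n.+1) * (m + n))%N.
  rewrite minnMl leq_min hD expnS mulnAC leq_mul2r Dc orbT //.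
apply: (@isolating_grid K r n.+1 c d m'); rewrite -(ltn_pmul2l M0) mulnCA.
have c0 : (0 < c ^ n.+1)%N by rewrite expn_gt0.
rewrite -(ltn_pmul2l c0) in hd; apply: leq_trans hd _.
rewrite expnS -mulnA [(c ^ n * _)%N]mulnA [(c ^ n * _)%N]mulnC.
rewrite [X in (_ <= X)%N](_ : _ = c * (minn r (c ^ n.+1) * (m + n) * m'))%N.
  by rewrite leq_mul2l leq_mul2r key !orbT.
by rewrite -expnS; move: (minn _ _) => q; nia.
Qed.

Unset Implicit Arguments.

Theorem theorem4p8 (R : realType) (N m r : nat)
    (hN : (1 <= N)%N) (hm : (1 <= m)%N) (hr : (m ^ N <= r)%N) :
  for_very_general (fun p : 'I_r -> proj_space (R[i])%C N =>
    let Z := range p in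
    ((initial_degree (symbolic_power Z m))%:R + N%:R - 1) / (m%:R + N%:R - 1)
      <= waldschmidt R Z).
Proof.
case: N hN hr => // n _ hr.
have r1 : (1 <= r)%N by apply: leq_trans hr; rewrite expn_gt0 hm.
pose excludes k (Wk : set ('I_r -> proj_space R[i]%C n.+1)) :=
  [/\ is_closed Wk, Wk <> setT & forall d m', unpickle k = Some (d, m') ->
    isolating_tuple R[i]%C r n.+1 d m' ->
    forall p, ~ Wk p -> ~ has_form (symbolic_power (range p) m') d].
have /choice[W hW] : forall k, exists Wk, excludes k Wk.
  move=> k.
  (* Pairs without isolating tuple get any proper closed subset. *)
  have triv : isolating_tuple R[i]%C r n.+1 0 1.
    by apply: (@isolating_grid _ r n.+1 1); rewrite exp1n muln0 (minn_idPr r1).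
  have [W0 [c0 t0 _]] := isolating_very_general triv.
  rewrite /excludes; case: (unpickle k) => [[d m']|]; last by exists W0.
  have [iso|niso] := pselect (isolating_tuple R[i]%C r n.+1 d m'); last first.
    by exists W0; split=> // e e' [<- <-].
  have [W1 [c1 t1 h1]] := isolating_very_general iso.
  by exists W1; split=> // e e' [<- <-].
exists W; split=> [k|p Wp]; first by have [] := hW k.
have noform d m' : isolating_tuple R[i]%C r n.+1 d m' ->
    ~ has_form (symbolic_power (range p) m') d.
  move=> iso; have [_ _ h] := hW (pickle (d, m')).
  by apply: h; [exact: pickleK|exact: iso|move=> Wk; apply: Wp; exists (pickle (d, m'))].
have form m' : (1 <= m')%N -> exists d, has_form (symbolic_power (range p) m') d.
  case: m' => // m' _; exists (r * 'C(m' + n.+1, m'))%N; apply: symbolic_power_has_form.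
  set d := (r * _)%N; apply: (@leq_trans 'C(d.+1, d)); first by rewrite binSn.
  by apply: leq_bin2l; rewrite -addn1 leq_add2l.
move=> Z; rewrite -/Z in noform form.
set a := initial_degree _.
have a_min e : has_form (symbolic_power Z m) e -> (a <= e)%N.
  by have [d hd] := form m hm; have [_] := initial_degreeP hd; apply.
have ratio d m' : has_form (symbolic_power Z m') d -> ((a + n) * m' <= (m + n) * d)%N.
  move=> hd; rewrite leqNgt; apply/negP => lt; apply: (noform d m') hd.
  apply: (isolating_tuple_ratio _ hm hr _ lt) => big.
  have a0 : (0 < a)%N by move: big; case: (a) => //; nia.
  rewrite leqNgt; apply/negP => hbin.
  have /a_min : has_form (symbolic_power Z m) a.-1.
    rewrite -[m]prednK //; apply: symbolic_power_has_form.
    have e1 : (m.-1 + n.+1 = m + n)%N by lia.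
    have e2 : (a.-1 + n.+1 = a + n)%N by lia.
    rewrite -[in X in (X < _)%N](@bin_sub _ m.-1) ?leq_addr //.
    rewrite -[X in (_ < X)%N](@bin_sub _ a.-1) ?leq_addr //.
    by rewrite !addKn e1 e2.
  by rewrite -ltnS prednK // ltnn.
apply: lb_le_inf.
  by exists ((initial_degree (symbolic_power Z 1))%:R / 1%:R), 1%N.
move=> _ [m' /= m'1 <-].
have [d hd] := form m' m'1.
have [/ratio h _] := initial_degreeP hd.
have M0 : 0 < m%:R + n.+1%:R - 1 :> R by rewrite -natr1 addrA addrK -natrD ltr0n; lia.
rewrite ler_pdivrMr // mulrAC ler_pdivlMr ?ltr0n //.
by rewrite -!natr1 !addrA !addrK -!natrD -!natrM ler_nat mulnC [X in (_ <= X)%N]mulnC mulnC.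
Qed.
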